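(* Let $d\ge 2$. The following statement is false: there exist $\delta>0$, $A\in\mathbb{R}$, $c>0$ and $C>0$ such that for every integer $N\ge 2$, every $f\in\mathcal{T}(N)$ and every measurable set $B\subset\mathbb{T}^d$ of normalized measure $|B|\le \big(cN(\log N)^A\big)^{-1}$ one has $$\|f\|_\infty\le C(\log N)^{(d-1)(1-\delta)}\sup_{\mathbf{u}\in\mathbb{T}^d\setminus B}|f(\mathbf{u})|.$$
   Context: $\mathbb{T}^d$ is the $d$-dimensional torus $[0,2\pi)^d$ (functions are $2\pi$-periodic in each variable), and $|B|$ is the normalized Lebesgue measure, so $|\mathbb{T}^d|=1$. The hyperbolic cross is $$\Gamma(N):=\Big\{\mathbf{k}=(k_1,\dots,k_d)\in\mathbb{Z}^d:\ \prod_{j=1}^d\bar k_j\le N\Big\},\qquad \bar k_j:=\max(1,|k_j|),$$ and $$\mathcal{T}(N):=\Big\{f:\ f(\mathbf{x})=\sum_{\mathbf{k}\in\Gamma(N)}c_{\mathbf{k}}e^{i(\mathbf{k},\mathbf{x})},\ c_{\mathbf{k}}\in\mathbb{C}\Big\}.$$ $\|f\|_\infty$ is the supremum norm over $\mathbb{T}^d$. *)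

(* Defs.v *)
From HB Require Import structures.
From mathcomp Require Import all_boot all_order all_algebra.
From mathcomp Require Import all_classical all_reals all_analysis.
From mathcomp Require Import complex.

Set Implicit Arguments.
Unset Strict Implicit.
Unset Printing Implicit Defensive.

Import Order.TTheory GRing.Theory Num.Theory.
Import numFieldNormedType.Exports.

Local Open Scope classical_set_scope.
Local Open Scope ring_scope.

Definition tuple_cons (T : Type) n (p : T * n.-tuple T) : n.+1.-tuple T :=
  [tuple of p.1 :: p.2].

Lemma measurable_tuple_cons d (T : measurableType d) n :
  measurable_fun [set: T * n.-tuple T] (@tuple_cons T n).
Proof. exact: (@measurable_cons _ _ _ _ fst n snd). Qed.

Section lebesgue_tupleS.
Variables (R : realType) (n : nat).
Variable mu : {sigma_finite_measure set (n.-tuple (measurableTypeR R)) -> \bar R}.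

Definition lebesgue_tupleS : set (n.+1.-tuple (measurableTypeR R)) -> \bar R :=
  pushforward (lebesgue_measure \x mu)%E (@tuple_cons _ n).

Let lebesgue_tupleS0 : lebesgue_tupleS set0 = 0%E.
Proof. by rewrite /lebesgue_tupleS /pushforward preimage_set0 measure0. Qed.

Let lebesgue_tupleS_ge0 A : (0 <= lebesgue_tupleS A)%E.
Proof. by rewrite /lebesgue_tupleS /pushforward measure_ge0. Qed.

Let lebesgue_tupleS_sigma_additive : semi_sigma_additive lebesgue_tupleS.
Proof.
move=> F mF tF mUF; rewrite /lebesgue_tupleS /pushforward preimage_bigcup.
have mT A : measurable A ->
    measurable (@tuple_cons (measurableTypeR R) n @^-1` A).
  by move=> mA; have := measurable_tuple_cons measurableT mA; rewrite setTI.
apply: measure_semi_sigma_additive.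
- by move=> i; exact: mT.
- apply/trivIsetP => /= i j _ _ ij; rewrite -preimage_setI.
  by move/trivIsetP : tF => /(_ _ _ _ _ ij) ->//; rewrite preimage_set0.
- by rewrite -preimage_bigcup; exact: mT.
Qed.

HB.instance Definition _ := isMeasure.Build _ _ _ lebesgue_tupleS
  lebesgue_tupleS0 lebesgue_tupleS_ge0 lebesgue_tupleS_sigma_additive.

Let lebesgue_tupleS_sigma_finite : sigma_finite setT lebesgue_tupleS.
Proof.
have /sigma_finiteP[F [FT ndF Foo]] := sigma_finiteT (@lebesgue_measure R).
have /sigma_finiteP[G [GT ndG Goo]] := sigma_finiteT mu.
pose uncons (t : n.+1.-tuple (measurableTypeR R)) :
  measurableTypeR R * n.-tuple (measurableTypeR R) :=
  (thead t, [tuple of behead t]).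
have uncons_consK : cancel (@tuple_cons (measurableTypeR R) n) uncons.
  by move=> [x t]; congr (_, _); exact: val_inj.
have muncons : measurable_fun setT uncons.
  apply/measurable_fun_pairP; split; first exact: measurable_tnth.
  exact: measurable_behead.
exists (fun k => uncons @^-1` (F k `*` G k)).
  rewrite -preimage_bigcup -[LHS](preimage_setT uncons); congr (_ @^-1` _).
  apply/seteqP; split=> // -[x y] _.
  have [k _ Fkx] : (\bigcup_k F k) x by rewrite -FT.
  have [l _ Gly] : (\bigcup_l G l) y by rewrite -GT.
  exists (maxn k l) => //; split => /=.
  - by move: x Fkx; exact/subsetPset/ndF/leq_maxl.
  - by move: y Gly; exact/subsetPset/ndG/leq_maxr.
move=> k; have [[mF Fk] [mG Gk]] := (Foo k, Goo k).
have mFG : measurable (F k `*` G k) by exact: measurableX.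
split; first by have := muncons measurableT _ mFG; rewrite setTI.
rewrite /lebesgue_tupleS /pushforward -comp_preimage.
rewrite (_ : uncons \o _ = id); last by apply/funext => x /=; rewrite uncons_consK.
by rewrite preimage_id product_measure1E// lte_mul_pinfty// ge0_fin_numE.
Qed.

HB.instance Definition _ := Measure_isSigmaFinite.Build _ _ _ lebesgue_tupleS
  lebesgue_tupleS_sigma_finite.

End lebesgue_tupleS.

(* The d-dimensional Lebesgue measure on Borel sets, as an iterated product. *)
Fixpoint lebesgue_tuple (R : realType) n :
    {sigma_finite_measure set (n.-tuple (measurableTypeR R)) -> \bar R} :=
  if n is m.+1 then lebesgue_tupleS (lebesgue_tuple R m)
  else \d_([tuple] : 0.-tuple (measurableTypeR R)).

(* The completion of lebesgue_tuple, built as completed_lebesgue_measure is for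
   d = 1; Lebesgue measurability is Caratheodory measurability for its outer
   measure. *)
Definition completed_lebesgue_tuple (R : realType) d (B : set (d.-tuple R)) :
    \bar R :=
  @completed_measure_extension _ _ _ (lebesgue_tuple R d) B.

Definition lebesgue_measurable (R : realType) d (B : set (d.-tuple R)) : Prop :=
  ((lebesgue_tuple R d)^*%mu).-cara.-measurable B.

Definition torus (R : realType) d : set (d.-tuple R) :=
  [set x | forall i, tnth x i \in `[0, 2 * pi[].
Arguments torus : clear implicits.

Definition torus_measure (R : realType) d (B : set (d.-tuple R)) : \bar R :=
  (((2 * pi) ^- d)%:E * completed_lebesgue_tuple B)%E.

Lemma measurable_torus (R : realType) d :
  measurable (torus R d : set (d.-tuple (measurableTypeR R))).
Proof.
rewrite (_ : torus R d =
  \bigcap_(i in [set` finset.setT]) ((@tnth d R)^~ i @^-1` [set` `[0, 2 * pi[])); last first.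
  apply/seteqP; split=> [x xT i _|x xT i]; first exact: xT.
  by apply: (xT i); rewrite /= finset.in_setT.
apply: fin_bigcap_measurable => [|i _]; first exact: finite_finset.
rewrite -[X in measurable X]setTI.
by apply: (@measurable_tnth _ (measurableTypeR R)) => //; exact: measurable_itv.
Qed.

Lemma lebesgue_tuple_torus (R : realType) d :
  lebesgue_tuple R d (torus R d) = ((2 * pi) ^+ d)%:E.
Proof.
elim: d => [|d IH].
  by rewrite /= diracE expr0 mem_set// => -[].
rewrite /= /lebesgue_tupleS /pushforward.
rewrite [X in product_measure1 _ _ X](_ : _ = [set` `[0, 2 * pi[] `*` torus R d).
  rewrite product_measure1E//; last exact: measurable_torus.
  have E : lebesgue_measure [set` `[0, (2 * pi : R)[] = (2 * pi)%:E.
    by rewrite lebesgue_measure_itv/= lte_fin mulr_gt0 ?pi_gt0// oppr0 adde0.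
  by rewrite [X in (X * _)%E]E [X in (_ * X)%E]IH -EFinM exprS.
apply/seteqP; split=> [[x t] /= xt|[x t] /= [x0 tT] i].
  split; first exact: (xt ord0).
  by move=> i; have := xt (lift ord0 i); rewrite tnthS.
by case: (unliftP ord0 i) => [j|] ->; rewrite ?tnthS ?tnth0//; exact: tT.
Qed.

Lemma torus_measure_torus (R : realType) d : torus_measure (torus R d) = 1%E.
Proof.
rewrite /torus_measure /completed_lebesgue_tuple /completed_measure_extension.
rewrite measurable_mu_extE; last exact: measurable_torus.
rewrite [X in (_ * X)%E]lebesgue_tuple_torus -EFinM mulVf//.
by rewrite expf_neq0// mulf_neq0// gt_eqF ?pi_gt0.
Qed.

Definition hyperbolic_cross d (N : nat) : set (d.-tuple int) :=
  [set k | (\prod_(j < d) maxn 1 `|tnth k j| <= N)%N].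
Arguments hyperbolic_cross : clear implicits.

(* Because of this, the sum \sum_(k \in hyperbolic_cross d N), which by convention is 0
   over an infinite support, is the intended finite sum. *)
Lemma finite_hyperbolic_cross d N : finite_set (hyperbolic_cross d N).
Proof.
pose f (k : {ffun 'I_d -> bool * 'I_N.+1}) : d.-tuple int :=
  [tuple (if (k i).1 then (k i).2%:Z else - (k i).2%:Z) | i < d].
apply: (@sub_finite_set _ _ (f @` setT)); last first.
  exact/finite_image/finite_finset.
move=> k /= kN.
have kiN i : (`|tnth k i| <= N)%N.
  apply: leq_trans kN; rewrite (bigD1 i)//= (leq_trans (leq_maxr 1 _))//.
  by rewrite leq_pmulr// prodn_gt0// => j; rewrite leq_max.
exists [ffun i => (0 <= tnth k i, inord `|tnth k i|%N)] => //.
apply: eq_from_tnth => i; rewrite tnth_mktuple ffunE /= inordK ?ltnS//.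
by case: ifPn => [/gez0_abs//|]; rewrite -ltNge => /ltz0_abs ->; rewrite opprK.
Qed.

Definition expi (R : realType) (t : R) : R[i] := (cos t +i* sin t)%C.

Definition dot (R : realType) d (k : d.-tuple int) (x : d.-tuple R) : R :=
  \sum_(j < d) (tnth k j)%:~R * tnth x j.

Definition hyperbolic_polys (R : realType) d (N : nat) :
    set (d.-tuple R -> R[i]) :=
  [set f | exists c : d.-tuple int -> R[i], forall x : d.-tuple R,
    f x = \sum_(k \in hyperbolic_cross d N) c k * expi (dot k x)].
Arguments hyperbolic_polys : clear implicits.

(* The supremum of |f| over D; it is 0 when D is empty. *)
Definition sup_norm_on (R : realType) d (D : set (d.-tuple R))
    (f : d.-tuple R -> R[i]) : R :=
  sup [set Normc.normc (f x) | x in D].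

(* Main.v *)
(* Let D_M be the Dirichlet kernel with frequencies 0, ..., M-1, normalized by
   D_M(0) = 1. For exponent vectors e with |e|_1 = n, the spike
   prod_i D_{2^(e_i)}(x_i) lies in T(2^n), is bounded by 1 and is at least eps
   in modulus only in a box of sides O(2^(-e_i) / eps). Take the T = m^(d-1)
   vectors whose first coordinate is determined by the d-1 others, these being
   multiples of L in [0, L m), and n = L (d-1) m. The sum f of their spikes
   has f(0) = T. For two different vectors the boxes meet in a box of measure
   O(2^(-n-L) eps^(-d)), because sum_i max(e_i, e'_i) >= n + L. So with
   eps = 1/T one has |f| <= 2 outside a set of measure at most
   2^(-n-L) T^(O(1)). Taking for m a large power of L, this measure is below
   1/(c N (log N)^A) with N = 2^n, whereas f(0) = T is almost
   (log N)^(d-1). *)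
Require Import Defs.
From HB Require Import structures.
From mathcomp Require Import all_boot all_order all_algebra.
From mathcomp Require Import finmap.
From mathcomp Require Import all_classical all_reals all_analysis.
From mathcomp Require Import complex ring lra zify.

Set Implicit Arguments.
Unset Strict Implicit.
Unset Printing Implicit Defensive.

Import Order.TTheory GRing.Theory Num.Theory.
Import numFieldNormedType.Exports Normc.

Local Open Scope classical_set_scope.
Local Open Scope ring_scope.

(** * Sine and complex exponentials *)

Lemma sin_ge_half_pihalf (R : realType) (u : R) :
  0 <= u <= pi / 2 -> u / 4 <= sin u.
Proof.
move=> /andP[u0 u2].
have pi0 : 0 < pi :> R by exact: pi_gt0.
have pi2 := pihalf_02 R.
have cs4 : cos (pi / 4) = sin (pi / 4) :> R.
  have := tan_piquarter R; rewrite /tan => t1.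
  have c0 : cos (pi / 4) != 0 :> R by rewrite gt_eqF// cos_gt0_pihalf//; lra.
  by rewrite -[RHS](divfK c0) t1 mul1r.
have s4 : 1 / 2 <= sin (pi / 4) :> R.
  have := cos2Dsin2 (pi / 4 : R); rewrite cs4 => e.
  have := sin_ge0_pi (x := pi / 4 : R); rewrite (_ : 0 <= _ <= _); last by lra.
  by move=> /(_ isT); nra.
(* Up to [pi / 4] the slope is at least [cos (pi / 4) >= 1 / 2]; beyond it, [sin u >= 1 / 2] by
   monotonicity, and [u < 2]. *)
have [u4|u4] := leP u (pi / 4).
  have [|c] := @MVT_segment R sin cos 0 u u0.

  by apply: continuous_subspaceT; exact: continuous_sin.
  rewrite in_itv/= sin0 !subr0 => /andP[c0 cu] ->.
  suff : cos (pi / 4) <= cos c by rewrite cs4; nra.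
  by rewrite leNgt ltr_cos ?in_itv/= -?leNgt; lra.
have : sin (pi / 4) <= sin u by rewrite leNgt ltr_sin ?in_itv/= -?leNgt; lra.
lra.
Qed.

Lemma expi0 (R : realType) : expi (0 : R) = 1.
Proof. by rewrite /expi cos0 sin0. Qed.

Lemma expiD (R : realType) (s t : R) : expi (s + t) = expi s * expi t.
Proof. by rewrite /expi cosD sinD; congr (_ +i* _)%C; rewrite addrC. Qed.

Lemma expi_sum (R : realType) (I : Type) (r : seq I) (P : pred I) (F : I -> R) :
  expi (\sum_(i <- r | P i) F i) = \prod_(i <- r | P i) expi (F i).
Proof. exact: (big_morph _ (@expiD R) (expi0 R)). Qed.

Lemma expiMn (R : realType) (t : R) n : expi (n%:R * t) = expi t ^+ n.
Proof.
elim: n => [|n IH]; first by rewrite mul0r expi0.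
by rewrite exprS -IH -expiD -[in LHS]nat1r mulrDl mul1r.
Qed.

Lemma normc_expi (R : realType) (t : R) : normc (expi t) = 1.
Proof. by rewrite /= cos2Dsin2 sqrtr1. Qed.

Lemma normc_ge0 (R : rcfType) (z : R[i]) : 0 <= normc z.
Proof. by case: z => a b; exact: sqrtr_ge0. Qed.

Lemma normc_sum (R : rcfType) (I : Type) (r : seq I) (P : pred I) (F : I -> R[i]) :
  normc (\sum_(i <- r | P i) F i) <= \sum_(i <- r | P i) normc (F i).
Proof.
elim/big_ind2 : _ => [|x a y b xa yb|//]; first by rewrite normc0.
by rewrite (le_trans (le_normcD _ _))// lerD.
Qed.

Lemma normc_prod (R : rcfType) (I : Type) (r : seq I) (P : pred I) (F : I -> R[i]) :
  normc (\prod_(i <- r | P i) F i) = \prod_(i <- r | P i) normc (F i).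
Proof. exact: (big_morph _ (@normcM R) (normc1 R)). Qed.

Lemma normc_real (R : rcfType) (a : R) : 0 <= a -> normc (a%:C%C) = a.
Proof. by move=> a0; rewrite /= expr0n addr0 sqrtr_sqr ger0_norm. Qed.

Lemma normc_expi_sub1 (R : realType) (t : R) :
  normc (expi t - 1) = 2 * `|sin (t / 2)|.
Proof.
have -> : expi t - 1 = ((cos t - 1)%R +i* sin t)%C.
  by apply/eqP; rewrite eq_complex /= subr0 !eqxx.
rewrite /= -[t in cos t](divfK (_ : 2 != 0 :> R))// -[t in sin t](divfK (_ : 2 != 0 :> R))//.
set u := t / 2.
rewrite !(mulr_natr u 2) cos_mulr2n sin_mulr2n -[2 in RHS]ger0_norm// -normrM -sqrtr_sqr.
congr Num.sqrt; have := cos2Dsin2 u; nra.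
Qed.

(** * The normalized Dirichlet kernel *)

Definition dirichlet (R : realType) M (t : R) : R[i] :=
  M%:R^-1 * \sum_(k < M) expi (k%:R * t).

Lemma dirichlet0 (R : realType) M : (0 < M)%N -> dirichlet M (0 : R) = 1.
Proof.
move=> M0; rewrite /dirichlet (eq_bigr (fun=> 1)); last first.
  by move=> k _; rewrite mulr0 expi0.
by rewrite sumr_const card_ord mulVf// pnatr_eq0 -lt0n.
Qed.

Lemma normc_natV (R : rcfType) M : normc (M%:R^-1 : R[i]) = M%:R^-1 :> R.
Proof.
by rewrite -[RHS]normc_real ?invr_ge0// fmorphV rmorph_nat.
Qed.

Lemma normc_dirichlet_le1 (R : realType) M (t : R) : normc (dirichlet M t) <= 1.
Proof.
rewrite normcM normc_natV; have [->|M0] := posnP M; first by rewrite invr0 mul0r.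
rewrite ler_pdivrMl ?ltr0n// mulr1 (le_trans (normc_sum _ _ _))//.
by under eq_bigr do rewrite normc_expi; rewrite sumr_const card_ord.
Qed.

(** The geometric sum gives [M D_M(t) (e^(it) - 1) = e^(iMt) - 1], of modulus at most 2, while
    [|e^(it) - 1| = 2 |sin (t / 2)|]. *)
Lemma normc_dirichlet_decay (R : realType) M (t : R) :
  M%:R * `|sin (t / 2)| * normc (dirichlet M t) <= 1.
Proof.
have [->|M0] := posnP M; first by rewrite !mul0r.
rewrite -(@ler_pM2l _ 2)// mulr1 mulrA (mulrCA 2) -normc_expi_sub1 -mulrA -normcM.
rewrite /dirichlet mulrCA normcM normc_natV mulrA mulfV ?pnatr_eq0 -?lt0n// mul1r.
under eq_bigr do rewrite expiMn.
rewrite -subrX1 -expiMn (le_trans (le_normcD _ _))// normcN normc1 normc_expi.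
by [].
Qed.

Lemma dirichlet_large (R : realType) M (t e : R) : (0 < M)%N -> 0 < e ->
  0 <= t < 2 * pi -> e <= normc (dirichlet M t) ->
  t <= 8 / (M%:R * e) \/ 2 * pi - 8 / (M%:R * e) <= t.
Proof.
move=> M0 e0 /andP[t0 t2pi] et.
have Me0 : 0 < M%:R * e by rewrite mulr_gt0 ?ltr0n.
have : `|sin (t / 2)| <= 1 / (M%:R * e).
  rewrite ler_pdivlMr// mulrC mulrAC (le_trans _ (normc_dirichlet_decay M t))//.
  by rewrite ler_wpM2l// mulr_ge0.
move=> st.
suff : Num.min t (2 * pi - t) <= 8 / (M%:R * e).
  by rewrite ge_min => /orP[]; [left|right; lra].
have pi0 : 0 < pi :> R by exact: pi_gt0.
(* The minimum is the distance from [t] to the multiples of [2 * pi]. Half of it lies in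
   [[0, pi / 2]], where sine is at least a quarter of its argument; hence the 8. *)
have h : Num.min t (2 * pi - t) / 8 <= `|sin (t / 2)|.
  have [tpi|pit] := leP t (2 * pi - t).
    have := @sin_ge_half_pihalf _ (t / 2) _; have := ler_norm (sin (t / 2)); lra.
  rewrite (_ : t / 2 = pi - (2 * pi - t) / 2); last by field.
  rewrite sinB sinpi cospi mul0r sub0r mulN1r opprK.
  have := @sin_ge_half_pihalf _ ((2 * pi - t) / 2) _.
  have := ler_norm (sin ((2 * pi - t) / 2)); lra.
have := le_trans h st; lra.
Qed.

(** * Polynomials with frequencies in the hyperbolic cross *)

Lemma hyperbolic_polysE (R : realType) d N (f : d.-tuple R -> R[i]) :
  hyperbolic_polys R d N f <-> exists c : d.-tuple int -> R[i], forall x,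
    f x = \sum_(k <- fset_set (hyperbolic_cross d N)) c k * expi (dot k x).
Proof.
have fin := finite_hyperbolic_cross d N.
by split=> -[c fc]; exists c => x; rewrite fc (fsbig_finite _ _ fin).
Qed.

Lemma hyperbolic_polys_sum (R : realType) d N (I : Type) (r : seq I) (P : pred I)
    (F : I -> d.-tuple R -> R[i]) :
  (forall i, P i -> hyperbolic_polys R d N (F i)) ->
  hyperbolic_polys R d N (fun x => \sum_(i <- r | P i) F i x).
Proof.
move=> hF; elim: r => [|i r IH].
  by apply/hyperbolic_polysE; exists (fun=> 0) => x; rewrite big_nil big1// => k _; rewrite mul0r.
have [Pi|Pi] := boolP (P i); last first.
  by congr (hyperbolic_polys R d N _): IH; apply/funext => x; rewrite big_cons (negbTE Pi).
have [/hyperbolic_polysE[c Fc] /hyperbolic_polysE[c' Fc']] := (hF i Pi, IH).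
apply/hyperbolic_polysE; exists (fun k => c k + c' k) => x.
rewrite big_cons Pi Fc Fc' -big_split/=.
by apply: eq_bigr => k _; rewrite mulrDl.
Qed.

Lemma hyperbolic_polys_monomial (R : realType) d N (a : R[i]) (k : d.-tuple int) :
  hyperbolic_cross d N k ->
  hyperbolic_polys R d N (fun x => a * expi (dot k x)).
Proof.
move=> kN; apply/hyperbolic_polysE; exists (fun l => if l == k then a else 0) => x.
rewrite (big_fsetD1 k)/= ?eqxx; last by rewrite in_fset_set ?inE//; exact: finite_hyperbolic_cross.
rewrite big1_fset ?addr0// => l; rewrite 2!inE => /andP[/negbTE -> _ _].
by rewrite mul0r.
Qed.

(** Expanding the product leaves only frequencies with [0 <= k_i < M i], for which
    [max(1, |k_i|) <= M i]. *)
Lemma prod_dirichlet_hyperbolic (R : realType) d N (M : 'I_d -> nat) :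
  (forall i, 0 < M i)%N -> (\prod_i M i <= N)%N ->
  hyperbolic_polys R d N (fun x => \prod_i dirichlet (M i) (tnth x i)).
Proof.
(* [B] bounds every [M i]: sums of different lengths are put over the single index type ['I_B], so
   that their product expands over finite functions. *)
move=> M0 MN; set B := (\sum_i M i)%N.
have MB i : (M i <= B)%N by rewrite /B (bigD1 i)//= leq_addr.
rewrite [f in hyperbolic_polys _ _ _ f](_ : _ = fun x =>
  \sum_(g in family (fun i => [pred k : 'I_B | (k < M i)%N]))
    (\prod_i (M i)%:R^-1) * expi (dot [tuple (g i)%:Z | i < d] x)).
  apply: hyperbolic_polys_sum => g /familyP gM.
  apply: hyperbolic_polys_monomial; apply: leq_trans MN.
  apply: leq_prod => i _; rewrite tnth_mktuple geq_max M0/=.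
  exact/ltnW/(gM i).
apply/funext => x; rewrite /dirichlet big_split/= -mulr_sumr; congr (_ * _).
under eq_bigr => i _ do rewrite (big_ord_widen _ (fun k => expi (k%:R * tnth x i)) (MB i)).
rewrite bigA_distr_big_dep/=.
apply: eq_bigr => g _; rewrite /dot expi_sum.
by apply: eq_bigr => i _; rewrite tnth_mktuple.
Qed.

(** * Measure of boxes and of finite unions *)

Definition box (T : Type) d (E : 'I_d -> set T) : set (d.-tuple T) :=
  [set x | forall i, E i (tnth x i)].

Lemma measurable_box (R : realType) d (E : 'I_d -> set (measurableTypeR R)) :
  (forall i, measurable (E i)) -> measurable (box E).
Proof.
move=> mE; rewrite (_ : box E =
  \bigcap_(i in [set` finset.setT]) ((@tnth d _)^~ i @^-1` E i)); last first.
  apply/seteqP; split=> [x xE i _|x xE i]; first exact: xE.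
  by apply: (xE i); rewrite /= finset.in_setT.
apply: fin_bigcap_measurable => [|i _]; first exact: finite_finset.
by rewrite -[X in measurable X]setTI; exact: measurable_tnth.
Qed.

Lemma lebesgue_tuple_box (R : realType) d (E : 'I_d -> set (measurableTypeR R))
    (a : 'I_d -> R) :
  (forall i, measurable (E i)) -> (forall i, lebesgue_measure (E i) <= (a i)%:E)%E ->
  (lebesgue_tuple R d (box E) <= (\prod_i a i)%:E)%E.
Proof.
elim: d E a => [|d IH] E a mE Ea.
  by rewrite /= diracE big_ord0 mem_set// => -[].
rewrite /= /lebesgue_tupleS /pushforward.
rewrite [X in product_measure1 _ _ X](_ : _ = E ord0 `*` box (fun i => E (lift ord0 i))).
  rewrite product_measure1E//; last by apply: measurable_box.
  by rewrite big_ord_recl EFinM lee_pmul//; [exact: Ea|apply: IH => i; [exact: mE|exact: Ea]].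
apply/seteqP; split=> [[x t] /= xt|[x t] /= [x0 tT] i].
  split; first exact: (xt ord0).
  by move=> i; have := xt (lift ord0 i); rewrite tnthS.
by case: (unliftP ord0 i) => [j|] ->; rewrite ?tnthS ?tnth0//; exact: tT.
Qed.

Lemma torus_measure_borel (R : realType) d (B : set (d.-tuple (measurableTypeR R))) :
  measurable B ->
  lebesgue_measurable B /\ torus_measure B = (((2 * pi) ^- d)%:E * lebesgue_tuple R d B)%E.
Proof.
move=> mB; split; first exact: caratheodory_measurable_mu_ext.
rewrite /torus_measure /completed_lebesgue_tuple /completed_measure_extension.
by rewrite measurable_mu_extE.
Qed.

Lemma measure_bigsetU_le (R : realType) dd (T : measurableType dd)
    (mu : {measure set T -> \bar R}) (I : Type) (r : seq I) (P : pred I)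
    (F : I -> set T) (a : R) : 0 <= a ->
  (forall i, P i -> measurable (F i)) ->
  (forall i, P i -> mu (F i) <= a%:E)%E ->
  (mu (\big[setU/set0]_(i <- r | P i) F i) <= ((size r)%:R * a)%:E)%E.
Proof.
move=> a0 mF Fa; elim: r => [|i r IH]; first by rewrite big_nil measure0 mul0r.
rewrite big_cons /= -nat1r mulrDl mul1r EFinD; case: ifPn => Pi.
  rewrite (le_trans (measureU2 _ _ _))//; [exact: mF|exact: bigsetU_measurable|].
  by rewrite leeD// Fa.
by rewrite (le_trans IH)// leeDr// lee_fin.
Qed.

(** One period of the closed [a]-neighbourhood of the multiples of [2 * pi]; the half-open period
    keeps boxes of such sets inside [torus]. *)
Definition near2piZ (R : realType) (a : R) : set (measurableTypeR R) :=
  [set` `[0, 2 * pi[] `&` ([set` `[0, a]] `|` [set` `[2 * pi - a, 2 * pi]]).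

Lemma measurable_near2piZ (R : realType) (a : R) : measurable (near2piZ a).
Proof.
by apply: measurableI; [|apply: measurableU]; exact: measurable_itv.
Qed.

Lemma lebesgue_segment (R : realType) (a b : R) : a <= b ->
  lebesgue_measure [set` `[a, b]] = (b - a)%:E.
Proof.
move=> ab; rewrite lebesgue_measure_itv/= lte_fin; case: ltP => // ba.
by rewrite (@le_anti _ _ a b) ?ab// subrr.
Qed.

Lemma lebesgue_near2piZ (R : realType) (a : R) : 0 <= a ->
  (lebesgue_measure (near2piZ a) <= (2 * a)%:E)%E.
Proof.
move=> a0; have mI (i : interval R) : measurable ([set` i] : set (measurableTypeR R)).
  exact: measurable_itv.
apply: (@le_trans _ _ (lebesgue_measure
    ([set` `[0%R, a]] `|` [set` `[2 * pi - a, 2 * pi]] : set (measurableTypeR R)))).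
  apply: le_measure; rewrite ?inE; last exact: subIsetr.
    exact: measurable_near2piZ.
  exact: measurableU.
rewrite (le_trans (measureU2 _ _ _))//.
have -> : (2 * a)%:E = (a%:E + a%:E)%E by rewrite -EFinD; congr EFin; ring.
apply: leeD.
  by rewrite [leLHS](lebesgue_segment a0) subr0.
by rewrite [leLHS]lebesgue_segment ?lee_fin; lra.
Qed.

(** * Exponent vectors *)

(* The first coordinate (index [ord0]) is the dependent one: it makes the
   exponents sum to [L * p * m]. *)
Definition exponent p m L (s : {ffun 'I_p -> 'I_m}) (i : 'I_p.+1) : nat :=
  if unlift ord0 i is Some j then (L * s j)%N
  else (L * (p * m - \sum_j s j))%N.

Lemma exponent_lift p m L (s : {ffun 'I_p -> 'I_m}) j :
  exponent L s (lift ord0 j) = (L * s j)%N.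
Proof. by rewrite /exponent liftK. Qed.

Lemma sum_exponent p m L (s : {ffun 'I_p -> 'I_m}) :
  (\sum_i exponent L s i = L * p * m)%N.
Proof.
rewrite big_ord_recl.
under eq_bigr do rewrite exponent_lift.
rewrite /exponent unlift_none.
(* Every [s j] is below [m], so the truncated subtraction in the first exponent is exact. *)
rewrite -big_distrr -mulnDr -mulnA subnK//.
rewrite -[X in (X * _)%N]card_ord -sum_nat_const.
by apply: leq_sum => j _; exact: ltnW.
Qed.

(* Two exponent vectors have equal sums and differ by multiples of [L], so if
   they are distinct some coordinate of the second exceeds that of the first by
   at least [L]. *)
Lemma sum_maxn_exponent p m L (s s' : {ffun 'I_p -> 'I_m}) : s != s' ->
  (L * p * m + L <= \sum_i maxn (exponent L s i) (exponent L s' i))%N.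
Proof.
move=> ss'; have [j sj] : exists j, s j != s' j.
  by apply/existsP; apply: contraR ss' => /existsPn h; apply/eqP/ffunP => j; apply/eqP/negbNE/h.
wlog lt_ss' : s s' {ss'} sj / (s j < s' j)%N => [hw|].
  have [|lt_s's|eq_ss'] := ltngtP (s j) (s' j); first exact: hw.
    by under eq_bigr do rewrite maxnC; apply: hw => //; rewrite eq_sym.
  by move/eqP : sj; case; exact: val_inj.
rewrite -(sum_exponent L s) (bigD1 (lift ord0 j))//= [leqRHS](bigD1 (lift ord0 j))//=.
rewrite addnAC leq_add//; last by apply: leq_sum => i _; exact: leq_maxl.
by rewrite !exponent_lift leq_max -mulnSr !leq_mul2l lt_ss' !orbT.
Qed.

(** * Spikes and their sum *)

Definition spike (R : realType) p m L (s : {ffun 'I_p -> 'I_m}) (x : p.+1.-tuple R) : R[i] :=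
  \prod_i dirichlet (2 ^ exponent L s i) (tnth x i).

Definition spikes_sum (R : realType) p m L (x : p.+1.-tuple R) : R[i] :=
  \sum_(s : {ffun 'I_p -> 'I_m}) spike L s x.
Arguments spikes_sum R p m L x : clear implicits.

Lemma hyperbolic_spikes_sum (R : realType) p m L :
  hyperbolic_polys R p.+1 (2 ^ (L * p * m)) (spikes_sum R p m L).
Proof.
apply: hyperbolic_polys_sum => s _; apply: prod_dirichlet_hyperbolic => [i|].
  by rewrite expn_gt0.
by rewrite -expn_sum sum_exponent.
Qed.

Lemma normc_spike_le1 (R : realType) p m L (s : {ffun 'I_p -> 'I_m}) (x : p.+1.-tuple R) :
  normc (spike L s x) <= 1.
Proof.
rewrite normc_prod prodr_ile1// => i _.
by rewrite normc_ge0 normc_dirichlet_le1.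
Qed.

Lemma normc_spike_le (R : realType) p m L (s : {ffun 'I_p -> 'I_m}) (x : p.+1.-tuple R) i :
  normc (spike L s x) <= normc (dirichlet (2 ^ exponent L s i) (tnth x i)).
Proof.
rewrite normc_prod (bigD1 i)//= ler_piMr ?normc_ge0// prodr_ile1// => j _.
by rewrite normc_ge0 normc_dirichlet_le1.
Qed.

Lemma spikes_sum0 (R : realType) p m L :
  spikes_sum R p m L [tuple 0 | _ < p.+1] = (m ^ p)%:R.
Proof.
rewrite /spikes_sum (eq_bigr (fun=> 1)) => [|s _].
  by rewrite sumr_const card_ffun !card_ord.
by rewrite /spike big1// => i _; rewrite tnth_mktuple dirichlet0// expn_gt0.
Qed.

Lemma normc_spikes_sum_le (R : realType) p m L (x : p.+1.-tuple R) :
  normc (spikes_sum R p m L x) <= (m ^ p)%:R.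
Proof.
rewrite (le_trans (normc_sum _ _ _))//
  (le_trans (ler_sum _ (fun s _ => normc_spike_le1 L s x)))//.
by rewrite sumr_const card_ffun !card_ord.
Qed.

(** At most one spike reaches [(m ^ p)^-1], and it is at most 1; the others, fewer than [m ^ p] in
    number, add up to at most 1. *)
Lemma normc_spikes_sum_le2 (R : realType) p m L (x : p.+1.-tuple R) :
  (forall s s' : {ffun 'I_p -> 'I_m}, s != s' ->
    normc (spike L s x) < (m ^ p)%:R^-1 \/ normc (spike L s' x) < (m ^ p)%:R^-1) ->
  normc (spikes_sum R p m L x) <= 2.
Proof.
move=> h; rewrite (le_trans (normc_sum _ _ _))//.
have sumV (P : pred {ffun 'I_p -> 'I_m}) : \sum_(s | P s) ((m ^ p)%:R^-1 : R) <= 1.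
  have [m0|m0] := eqVneq (m ^ p)%N 0%N; first by rewrite m0 invr0 big1.
  rewrite sumr_const -[X in X <= _]mulr_natl ler_pdivrMr ?ltr0n ?lt0n// mul1r ler_nat.
  by rewrite (leq_trans (max_card _))// card_ffun !card_ord.
have [/existsP[s0 s0large]|/existsPn small] :=
    boolP [exists s : {ffun 'I_p -> 'I_m}, (m ^ p)%:R^-1 <= normc (spike L s x)].
  rewrite (bigD1 s0)//= -[2]/(1 + 1) lerD ?normc_spike_le1//.
  rewrite (le_trans _ (sumV (fun s => s != s0)))//; apply: ler_sum => s ss0.
  by have [/ltW//|] := h _ _ ss0; rewrite ltNge s0large.
rewrite (@le_trans _ _ 1)// ?ler1n// (le_trans _ (sumV xpredT))//.
by apply: ler_sum => s _; rewrite leNgt; apply: contra (small s) => /ltW.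
Qed.

(** * The exceptional set where two spikes are large *)

(* Each box contains the points where both spikes of the pair are at least
   [(m ^ p)^-1] in modulus. *)
Definition spike_overlap (R : realType) p m L : set (p.+1.-tuple (measurableTypeR R)) :=
  \big[setU/set0]_(ss : {ffun 'I_p -> 'I_m} * {ffun 'I_p -> 'I_m} | ss.1 != ss.2)
    box (fun i => near2piZ (8 * (m ^ p)%:R / 2 ^+ maxn (exponent L ss.1 i) (exponent L ss.2 i))).
Arguments spike_overlap R p m L : clear implicits.

Lemma measurable_spike_overlap (R : realType) p m L : measurable (spike_overlap R p m L).
Proof.
apply: bigsetU_measurable => ss _; apply: measurable_box => i; exact: measurable_near2piZ.
Qed.

Lemma spike_overlap_torus (R : realType) p m L :
  spike_overlap R p m L `<=` torus R p.+1.
Proof.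
rewrite /spike_overlap -bigcup_pred => x [ss _ xss] i; exact: (xss i).1.
Qed.

Lemma normc_spikes_sum_off_overlap (R : realType) p m L (x : p.+1.-tuple R) :
  (0 < m)%N -> (torus R p.+1 `\` spike_overlap R p m L) x ->
  normc (spikes_sum R p m L x) <= 2.
Proof.
move=> m0 [xT xB]; apply: normc_spikes_sum_le2 => s s' ss'.
have [|s1] := ltP (normc (spike L s x)) (m ^ p)%:R^-1; first by left.
have [|s2] := ltP (normc (spike L s' x)) (m ^ p)%:R^-1; first by right.
exfalso; apply: xB; rewrite /spike_overlap -bigcup_pred.
exists (s, s') => //= i.
have mp0 : 0 < (m ^ p)%:R^-1 :> R by rewrite invr_gt0 ltr0n expn_gt0 m0.
have /= xi := xT i; split; first exact: xi.
(* Since all factors are at most 1, a large spike has only large factors; in each coordinate the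
   factor with the larger exponent confines the point to the smaller set. *)
set k := maxn _ _.
have large : (m ^ p)%:R^-1 <= normc (dirichlet (2 ^ k) (tnth x i)).
  rewrite /k /maxn; case: ifP => _.
    exact: le_trans s2 (normc_spike_le _ _ _ _).
  exact: le_trans s1 (normc_spike_le _ _ _ _).
have := dirichlet_large _ mp0 _ large; rewrite expn_gt0/= => /(_ isT xi).
rewrite natrX invfM invrK [2 ^- k * _]mulrC mulrA.
move: xi; rewrite in_itv/= => /andP[x0 x2pi].
by case=> [xle|xge]; [left|right]; rewrite /= in_itv/= ?x0 ?xle ?xge ?(ltW x2pi).
Qed.

(** Union bound over at most [(m ^ p) ^ 2] pairs. Each side of a box has measure at most
    [2 * 8 * m ^ p / 2 ^ max], and the maxima add up to at least [L * p * m + L]. The normalization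
    factor is bounded by 1. *)
Lemma torus_measure_overlap (R : realType) p m L :
  (torus_measure (spike_overlap R p m L) <=
     (16 ^+ p.+1 * (m ^ p)%:R ^+ p.+3 / 2 ^+ (L * p * m + L))%:E)%E.
Proof.
have mB := @measurable_spike_overlap R p m L.
rewrite (torus_measure_borel mB).2.
have le1 : (2 * pi : R) ^- p.+1 <= 1.
  rewrite invf_le1 ?exprn_gt0 ?mulr_gt0 ?pi_gt0// exprn_ege1//.
  by have := pi_ge2 R; lra.
apply: (@le_trans _ _ (lebesgue_tuple R p.+1 (spike_overlap R p m L))).
  by rewrite gee_pMl// ?lee_fin//.
set T : R := (m ^ p)%:R.
set I := ({ffun 'I_p -> 'I_m} * {ffun 'I_p -> 'I_m})%type.
apply: (@le_trans _ _ ((size (index_enum I))%:R *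
    ((16 * T) ^+ p.+1 / 2 ^+ (L * p * m + L)))%:E).
  apply: measure_bigsetU_le => [|ss _|[s s'] /= ss'].
  - by rewrite divr_ge0 ?exprn_ge0// mulr_ge0 ?ler0n.
  - by apply: measurable_box => i; exact: measurable_near2piZ.
  apply: le_trans.
    apply: (lebesgue_tuple_box (a := fun i =>
      2 * (8 * T / 2 ^+ maxn (exponent L s i) (exponent L s' i)))) => i.
      exact: measurable_near2piZ.
    by apply: lebesgue_near2piZ; rewrite divr_ge0 ?exprn_ge0// mulr_ge0 ?ler0n.
  rewrite lee_fin (eq_bigr (fun i =>
    (16 * T) * 2 ^- maxn (exponent L s i) (exponent L s' i))); last first.
    by move=> i _; rewrite !mulrA -natrM.
  rewrite big_split/= prodr_const card_ord ler_wpM2l//.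
    by rewrite exprn_ge0// mulr_ge0 ?ler0n.
  rewrite prodfV -expr_sum lef_pV2 ?posrE ?exprn_gt0//.
  by rewrite ler_weXn2l ?ler1n// sum_maxn_exponent.
rewrite lee_fin.
rewrite -sum1_size sum1_card card_prod card_ffun !card_ord natrM -/T exprMn.
rewrite [T ^+ p.+3]exprS [T ^+ p.+2]exprS.
set X := 16 ^+ _; set Y := T ^+ _; set Z := 2 ^- _.
by rewrite le_eqVlt; apply/orP; left; apply/eqP; ring.
Qed.

Lemma spikes_sum_norm_ge (R : realType) p m L :
  (m ^ p)%:R <= sup_norm_on (torus R p.+1) (spikes_sum R p m L).
Proof.
apply: ub_le_sup.
  by exists (m ^ p)%:R => _ [x _ <-]; exact: normc_spikes_sum_le.
exists [tuple 0 | _ < p.+1].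
  by move=> i; rewrite tnth_mktuple in_itv/= lexx mulr_gt0// pi_gt0.
by rewrite spikes_sum0 -(normc_real (ler0n R (m ^ p))) rmorph_nat.
Qed.

Lemma spikes_sum_norm_off_overlap_le (R : realType) p m L : (0 < m)%N ->
  sup_norm_on (torus R p.+1 `\` spike_overlap R p m L) (spikes_sum R p m L) <= 2.
Proof.
move=> m0; rewrite /sup_norm_on; set A := (X in sup X).
(* If the overlap fills the torus, the supremum is 0 by convention. *)
have [->|/set0P A0] := eqVneq A set0; first by rewrite sup0.
apply: ge_sup => // _ [x xT <-]; exact: normc_spikes_sum_off_overlap.
Qed.

(** * Choice of the parameters *)

Lemma exists_pow2_ge (R : realType) (x : R) : exists k, x <= 2 ^+ k.
Proof.
exists (Num.bound `|x|); rewrite (le_trans (ler_norm x))//.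
rewrite (le_trans (ltW (archi_boundP (normr_ge0 x))))// -natrX ler_nat.
by rewrite ltnW// ltn_expl.
Qed.

(** Turns real powers of [ln N] into integer powers of 2. A nonpositive exponent is harmless because
    [1 <= x]. *)
Lemma powR_le_pow2 (R : realType) (x r : R) (k l : nat) :
  1 <= x <= 2 ^+ k -> r * k%:R <= l%:R -> x `^ r <= 2 ^+ l.
Proof.
move=> /andP[x1 xk] rkl; have [r0|r0] := leP r 0.
  by rewrite (@le_trans _ _ 1) ?exprn_ege1// ?ler1n// -(powRr0 x) ler_powR.
rewrite (@le_trans _ _ ((2 ^+ k) `^ r))//.
  by rewrite ge0_ler_powR ?nnegrE ?(ltW r0) ?(le_trans _ x1) ?exprn_ge0.
by rewrite -!powR_mulrn// -powRrM ler_powR// ?ler1n// mulrC.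
Qed.

(** Both sides are compared with [j * j]. *)
Lemma linear_le_pow2 a b j : (a + b + 4 <= j)%N -> (a * j + b <= 2 ^ j)%N.
Proof.
move=> abj; apply: (@leq_trans (j * j)%N); first by nia.
have : (4 <= j)%N by lia.
elim: j {abj} => // j IH; rewrite leq_eqVlt => /orP[/eqP <-//|j4].
by rewrite expnS; have := IH j4; nia.
Qed.

Lemma ln2_bounds (R : realType) : 1 / 2 <= ln (2 : R) <= 1.
Proof.
have h := @le_ln1Dx R 1; have h' := @le_ln1Dx R (- (1 / 2)).
have e : ln (1 + - (1 / 2)) = - ln 2 :> R.
  by rewrite -lnV ?posrE//; congr ln; field.
by apply/andP; move: h' h; rewrite e => h' h; split; [have := h' _; lra|have := h _; lra].
Qed.

(* [L = 2 ^ j] and [m = L ^ (u + 1)] with [delta * u >= 2]: then [m ^ p] is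
   polynomial in [L], so negligible against [2 ^ L], while [ln N] exceeds [m]
   only by a factor of order [L = m ^ (1 / (u + 1))], which the gain
   [delta] in the exponent absorbs. *)
Lemma remez_parameters (R : realType) (p : nat) (delta A c C : R) : (0 < p)%N ->
  0 < delta -> 0 < c -> 0 < C ->
  exists m L : nat, let N := (2 ^ (L * p * m))%N in
   [/\ (0 < m)%N, (2 <= N)%N,
       16 ^+ p.+1 * (m ^ p)%:R ^+ p.+3 / 2 ^+ (L * p * m + L)
         <= (c * N%:R * ln N%:R `^ A)^-1
     & C * ln N%:R `^ (p%:R * (1 - delta)) * 2 < (m ^ p)%:R].
Proof.
move=> p0 delta0 c0 C0.
have [c' cc'] := exists_pow2_ge c.
have [C' CC'] := exists_pow2_ge (C * 2).
have [a Aa] : exists a : nat, A <= a%:R.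
  by exists (Num.bound `|A|); rewrite (le_trans (ler_norm A))// ltW// archi_boundP.
have [u du] : exists u : nat, 2 <= delta * u%:R.
  exists (Num.bound (2 / delta)); rewrite mulrC -ler_pdivrMr//.
  by rewrite ltW// archi_boundP// divr_ge0// ltW.
(* In base 2, the measure condition becomes [K1 * j + K0 <= 2 ^ j = L]: the terms come from
   [ln N ^ A], from [(m ^ p) ^ (p + 3)], from [c] and from [16 ^ (p + 1)]. *)
pose K1 := (a * u.+2 + u.+1 * p * p.+3)%N.
pose K0 := (c' + a * p + 4 * p.+1)%N.
have [j jK jC] : exists2 j, (K1 + K0 + 4 <= j)%N & (C' + p * p < j)%N.
  exists (K1 + K0 + 4 + (C' + p * p).+1)%N; first exact: leq_addr.
  exact: leq_addl.
have K2j := linear_le_pow2 jK.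
exists (2 ^ (j * u.+1))%N, (2 ^ j)%N => N.
have nE : (2 ^ j * p * 2 ^ (j * u.+1) = p * 2 ^ (j * u.+2))%N.
  by rewrite mulnC mulnA -expnD mulnC; congr (_ * 2 ^ _)%N; lia.
rewrite nE in N *.
set n := (p * _)%N in N *.
(* Chosen so that [ln N <= n <= 2 ^ k], using [p <= 2 ^ p]. *)
pose k := (j * u.+2 + p)%N.
have n2 : (2 <= n)%N.
  rewrite /n (@leq_trans (1 * 2 ^ 1))// leq_mul// leq_exp2l//; lia.
have nk : (n <= 2 ^ k)%N.
  by rewrite /n /k expnD mulnC leq_mul2l ltnW ?orbT// ltn_expl.
have lnN : ln N%:R = n%:R * ln 2 :> R by rewrite /N natrX lnXn// mulr_natl.
have /andP[ln2l ln2u] := ln2_bounds R.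
have lnNk : 1 <= ln (N%:R : R) <= 2 ^+ k.
  have n2R : 2 <= n%:R :> R by rewrite ler_nat.
  have nkR : n%:R <= 2 ^+ k :> R by rewrite -natrX ler_nat.
  rewrite lnN; apply/andP; split; nra.
have TE : (((2 ^ (j * u.+1)) ^ p)%N)%:R = 2 ^+ (j * u.+1 * p) :> R.
  by rewrite -expnM natrX.
split; first by rewrite expn_gt0.
- by rewrite -[X in (X <= _)%N]expn1 leq_exp2l// ltnW.
- rewrite TE -[X in _ <= X]div1r -[16]/(16%:R) (_ : 16%:R = 2 ^+ 4 :> R); last by rewrite -natrX.
  have NA0 : 0 < c * N%:R * ln N%:R `^ A.
    rewrite !mulr_gt0 ?powR_gt0 ?ltr0n ?expn_gt0//.
    by move: lnNk => /andP[h _]; exact: lt_le_trans h.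
  rewrite ler_pdivlMr// mulrAC ler_pdivrMr ?exprn_gt0// mul1r.
  have Ak : ln N%:R `^ A <= 2 ^+ (a * k).
    apply: powR_le_pow2 (lnNk) _; rewrite natrM ler_wpM2r//.
  have NE : N%:R = 2 ^+ n :> R by rewrite natrX.
  set y := ln N%:R `^ A in Ak *.
  rewrite NE -!exprM -[X in X * _ <= _]exprD.
  apply: (@le_trans _ _ (2 ^+ (4 * p.+1 + j * u.+1 * p * p.+3) *
      (2 ^+ c' * 2 ^+ n * 2 ^+ (a * k)))).
    rewrite ler_wpM2l ?exprn_ge0// ler_pM ?powR_ge0// ?mulr_ge0 ?exprn_ge0 ?(ltW c0)//.
    by rewrite ler_wpM2r ?exprn_ge0.
  rewrite -!exprD ler_weXn2l ?ler1n//.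
  rewrite (_ : _ + _ = n + (K1 * j + K0))%N ?leq_add2l// /K1 /K0 /k; ring.
- rewrite TE -mulrAC.
  (* From [2 <= delta * u] follows [(1 - delta) * (u + 2) <= u], so [(1 - delta) * k <= j * u + p].
     The remaining factor [2 ^ (p * j)] of [m ^ p] then exceeds [2 ^ (C' + p * p)], as
     [C' + p * p < j]. *)
  apply: (@le_lt_trans _ _ (2 ^+ C' * 2 ^+ (p * (j * u + p)))).
    rewrite ler_pM ?powR_ge0 ?mulr_ge0 ?(ltW C0)//.
    apply: powR_le_pow2 (lnNk) _.
    rewrite /k !(natrM, natrD) -[leLHS]mulrA ler_wpM2l// -[u.+2]addn2 natrD.
    have p0R : 0 <= p%:R :> R by [].
    have j0R : 0 <= j%:R :> R by [].
    have := ler_wpM2l j0R du; have := mulr_ge0 (ltW delta0) j0R.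
    have := mulr_ge0 (ltW delta0) p0R; nra.
  rewrite -exprD ltr_eXn2l ?ltr1n//.
  by have := leq_pmull j p0; lia.
Qed.

Theorem proposition3p1 (R : realType) (d : nat) (d_ge2 : (2 <= d)%N) :
  ~ (exists delta A c C : R,
      [/\ 0 < delta, 0 < c, 0 < C &
        forall (N : nat) (f : d.-tuple R -> R[i]) (B : set (d.-tuple R)),
          (2 <= N)%N ->
          f \in hyperbolic_polys R d N ->
          B `<=` torus R d ->
          lebesgue_measurable B ->
          (torus_measure B <= ((c * N%:R * ln N%:R `^ A)^-1)%:E)%E ->
          sup_norm_on (torus R d) f <=
            C * ln N%:R `^ ((d%:R - 1) * (1 - delta))
              * sup_norm_on (torus R d `\` B) f]).
Proof.
case: d d_ge2 => // p p_gt0 [delta [A [c [C [delta0 c0 C0 remez]]]]].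
have [m [L [m0 N2 measure_small large]]] := remez_parameters A p_gt0 delta0 c0 C0.
have mB := @measurable_spike_overlap R p m L.
have := remez _ (spikes_sum R p m L) (spike_overlap R p m L) N2.
rewrite inE => /(_ (hyperbolic_spikes_sum _ _ _ _)) /(_ (@spike_overlap_torus _ _ _ _)).
move=> /(_ (torus_measure_borel mB).1).
move=> /(_ (le_trans (torus_measure_overlap _ _ _ _) _)); rewrite lee_fin => /(_ measure_small).
(* The assumed inequality would bound [m ^ p] by [C * ln N ^ (p * (1 - delta)) * 2], which is
   smaller. *)
rewrite leNgt => /negP; apply; apply: lt_le_trans (spikes_sum_norm_ge R p m L).
apply: le_lt_trans large; rewrite -natr1 addrK.
by rewrite ler_wpM2l ?spikes_sum_norm_off_overlap_le// mulr_ge0 ?powR_ge0// ltW.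
Qed.
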